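(* For every sign matrix $A$ with $s_{\max}(A)\le d$, $$\operatorname{signrk}(A)\;\le\;2\,f(d)^2\;\le\;2^{2^{O(d\log d)}},$$ where $f$ is the function from Theorem 2.1 of Atminas, ''Classes of graphs without star forests and related graphs'' (described in the context).
   Context: A sign matrix is a finite matrix with entries in $\{\pm1\}$. The sign-rank $\operatorname{signrk}(A)$ is the minimum rank of a real matrix $B$ of the same size with $\operatorname{sign}(B_{ij})=A_{ij}$ for all $i,j$. Star number. For a class $\mathcal{C}\subseteq\{\pm1\}^{\mathcal{X}}$ over a finite set $\mathcal{X}$ and a center $h\in\{\pm1\}^{\mathcal{X}}$, $s_h(\mathcal{C})$ is the largest $m$ for which there exist distinct points $x_1,\dots,x_m\in\mathcal{X}$ and concepts $c_0,c_1,\dots,c_m\in\mathcal{C}$ such that $c_i(x_j)=h(x_j)\iff i\ne j$ for every $i\in\{0,\dots,m\}$ and $j\in\{1,\dots,m\}$. Put $s_{\max}(\mathcal{C})=\max_{h\in\{\pm1\}^{\mathcal{X}}}s_h(\mathcal{C})$. For a sign matrix $A$, $s_{\max}(A)=s_{\max}(\mathcal{C}_A)$, where $\mathcal{X}$ is the set of columns of $A$ and $\mathcal{C}_A$ consists of the functions $j\mapsto A_{ij}$, one for each row $i$. The function $f$ (A. Atminas, ''Classes of graphs without star forests and related graphs'', Discrete Mathematics 345 (2022), Theorem 2.1): a function with $f(d)\le 2^{2^{O(d\log d)}}$ such that whenever a bipartite graph $G=(P\cup Q,E)$ and its bipartite complement (same parts $P,Q$, edge set $(P\times Q)\setminus E$)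 both omit induced matchings of size $d$, the parts admit partitions $P=P_1\cup\dots\cup P_u$ and $Q=Q_1\cup\dots\cup Q_u$ with $u\le f(d)$ such that every induced subgraph $G[P_i,Q_j]$ contains no induced copy of $2K_2$ (an induced matching with two edges). *)

(* Defs.v *)
From HB Require Import structures.
From mathcomp Require Import all_boot all_order all_algebra.
From mathcomp Require Import all_classical all_reals all_analysis.

Set Implicit Arguments.
Unset Strict Implicit.
Unset Printing Implicit Defensive.

Import Order.TTheory GRing.Theory Num.Theory.
Import numFieldNormedType.Exports.

Local Open Scope classical_set_scope.
Local Open Scope ring_scope.

(* Signs are encoded by booleans: true is +1 and false is -1 (this is not the
   exponent convention (-1) ^+ b). *)
Definition sign_val (b : bool) : int := if b then 1 else -1.

Section SignRank.
Variables (R : realType) (m n : nat).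

Definition sign_represents (B : 'M[R]_(m, n)) (A : 'M[bool]_(m, n)) : Prop :=
  forall i j, sgz (B i j) = sign_val (A i j).

Lemma ex_sign_rank (A : 'M[bool]_(m, n)) :
  exists r, `[< exists2 B : 'M[R]_(m, n), sign_represents B A & \rank B = r >].
Proof.
pose B : 'M[R]_(m, n) := \matrix_(i, j) (sign_val (A i j))%:~R.
exists (\rank B); apply/asboolP; exists B => // i j.
by rewrite mxE /sign_val; case: (A i j); rewrite ?rmorphN ?sgzN sgz1.
Qed.

Definition sign_rank (A : 'M[bool]_(m, n)) : nat := ex_minn (ex_sign_rank A).

End SignRank.

Section StarNumber.
Variable X : finType.
Implicit Types (C : {set {ffun X -> bool}}) (h : {ffun X -> bool}).

(* The points x_1, ..., x_m are indexed by j : 'I_m, with j standing for j + 1;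
   the concepts c_0, ..., c_m are indexed by i : 'I_m.+1. *)
Definition is_star C h m (x : {ffun 'I_m -> X})
    (c : {ffun 'I_m.+1 -> {ffun X -> bool}}) : bool :=
  [&& injectiveb x, [forall i, c i \in C] &
      [forall i, forall j, (c i (x j) == h (x j)) == (i != lift ord0 j)]].

Definition has_star C h m : bool :=
  [exists x : {ffun 'I_m -> X}, exists c, is_star C h x c].

(* The points of a star are distinct, so m <= #|X| always holds.  If C is empty
   there is no star at all and the value is 0. *)
Definition star_number C h : nat := \max_(m < #|X|.+1 | has_star C h m) m.

Definition max_star_number C : nat := \max_(h : {ffun X -> bool}) star_number C h.

End StarNumber.

Definition concept_class m n (A : 'M[bool]_(m, n)) : {set {ffun 'I_n -> bool}} :=
  [set [ffun j => A i j] | i : 'I_m].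

Definition smax m n (A : 'M[bool]_(m, n)) : nat :=
  max_star_number (concept_class A).

(* A bipartite graph with parts P and Q is given by its edges E : P -> Q -> bool. *)
Section Bipartite.
Variables P Q : finType.

Definition bip_compl (E : P -> Q -> bool) : P -> Q -> bool :=
  fun p q => ~~ E p q.

Definition bip_induced (E : P -> Q -> bool) (S : {set P}) (T : {set Q}) :
    {p : P | p \in S} -> {q : Q | q \in T} -> bool :=
  fun p q => E (val p) (val q).

Definition has_induced_matching (E : P -> Q -> bool) (d : nat) : Prop :=
  exists (p : 'I_d -> P) (q : 'I_d -> Q),
    [/\ injective p, injective q & forall i j, E (p i) (q j) = (i == j)].

End Bipartite.

(* Parts may be empty. *)
Definition is_partition (T : finType) (u : nat) (F : 'I_u -> {set T}) : Prop :=
  forall x, exists! i, x \in F i.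

Definition chain_partition_bound (f : nat -> nat) : Prop :=
  forall (d : nat) (P Q : finType) (E : P -> Q -> bool),
    ~ has_induced_matching E d ->
    ~ has_induced_matching (bip_compl E) d ->
    exists (u : nat) (Ps : 'I_u -> {set P}) (Qs : 'I_u -> {set Q}),
      [/\ (u <= f d)%N, is_partition Ps, is_partition Qs &
          forall i j, ~ has_induced_matching (@bip_induced P Q E (Ps i) (Qs j)) 2].

(* F(d) <= 2^(2^(O(d log d))); the O is the asymptotic one, as d tends to
   infinity (d log d vanishes at d = 0 and d = 1). *)
Definition double_exp_bounded (R : realType) (F : nat -> nat) : Prop :=
  exists2 g : nat -> R,
    g =O_\oo (fun d : nat => d%:R * ln d%:R : R) &
    forall d, (F d)%:R <= 2 `^ (2 `^ g d) :> R.

Definition atminas_function (R : realType) (f : nat -> nat) : Prop :=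
  chain_partition_bound f /\ double_exp_bounded R f.

(* Main.v *)
Require Import Defs.
From mathcomp Require Import all_boot all_order all_algebra.
From mathcomp Require Import all_classical all_reals all_analysis.
From mathcomp Require Import zify ring.

Set Implicit Arguments.
Unset Strict Implicit.
Unset Printing Implicit Defensive.

Import Order.TTheory GRing.Theory Num.Theory.

(* Colour P and Q so that no induced 2K2 is monochromatic on both sides; the
   colour classes are then the parts, each pair of parts spans a chain graph,
   and a chain graph is a threshold pattern, represented by a matrix of rank
   at most 2, which gives the factor 2 u^2 for the sign-rank.

   The number of colours is bounded by induction on s + t, where G has no
   induced matching of size s and its bipartite complement none of size t.  An
   edge (a, b) reduces the pairs (p, q) with p not adjacent to b and q not
   adjacent to a: they span a graph without induced matchings of size s - 1.
   Dually for non-edges and t.  Take a longest half graph a_i ~ b_j <-> i <= j,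
   1 <= i, j <= n.  A pair (p, q) that no (a_i, b_j) reduces has a position: p
   is adjacent exactly to the b_j after it, q exactly to the a_i before it; by
   maximality, pairs between two consecutive positions span a chain graph.
   A pair (p0, q0) that contradicts its positions i and j reduces, together
   with one or two vertices of the half graph, all pairs lying between i and
   j.  Cutting [0, n + 1] greedily into the longest stretches that can be
   coloured this way, each such contradiction is confined to two consecutive
   stretches; hence vertices which are a few stretches apart are adjacent or
   not according to their order only, so colouring the stretches periodically
   makes them independent of each other.  Inside a window of boundedly many
   stretches, a minimal-transversal argument (breadth) shows that O(d) of the
   (a_i, b_j) decide on which side of a cut a pair lies.  Each step thus raises the
   number of colours to a power O(d), and 2d steps give 2^(2^(O(d log d))). *)

(** * Colourings without monochromatic 2K2 *)

(* Only the 2K2's with an edge in R have to be broken, but they may leave R: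
   this is what makes chain_coloringU a plain product of colourings. *)
Definition chain_coloring (P Q : finType) (E : P -> Q -> bool)
    (u : nat) (R : P -> Q -> Prop) : Prop :=
  exists (cp : P -> 'I_u) (cq : Q -> 'I_u), forall p p' q q',
    cp p = cp p' -> cq q = cq q' -> R p q -> E p q -> E p' q' ->
    E p q' || E p' q.

Lemma has_induced_matchingI (P Q : finType) (E : P -> Q -> bool) (d : nat)
    (p : 'I_d -> P) (q : 'I_d -> Q) :
  (forall i j, E (p i) (q j) = (i == j)) -> has_induced_matching E d.
Proof.
move=> M; exists p, q; split=> // i j ij; apply/eqP.
  by rewrite -M ij M.
by rewrite eq_sym -M ij M.
Qed.

Section ChainColoring.
Variables (P Q : finType) (E : P -> Q -> bool).
Implicit Types R : P -> Q -> Prop.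

Lemma chain_coloring_fin (T U : finType) (u : nat) R (cp : P -> T) (cq : Q -> U) :
  (#|T| <= u)%N -> (#|U| <= u)%N ->
  (forall p p' q q', cp p = cp p' -> cq q = cq q' -> R p q -> E p q ->
    E p' q' -> E p q' || E p' q) ->
  chain_coloring E u R.
Proof.
move=> leT leU H.
exists (fun p => widen_ord leT (enum_rank (cp p))).
exists (fun q => widen_ord leU (enum_rank (cq q))) => p p' q q'.
have inj n m (le : (n <= m)%N) : injective (widen_ord le).
  by move=> i j /(congr1 val) /= ij; apply: val_inj.
by move=> /inj/enum_rank_inj ep /inj/enum_rank_inj eq; apply: H.
Qed.

Lemma chain_coloring_sub (u v : nat) R R' :
  (u <= v)%N -> (forall p q, R' p q -> R p q) ->
  chain_coloring E u R -> chain_coloring E v R'.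
Proof.
move=> uv sub [cp [cq H]].
apply: (@chain_coloring_fin 'I_u 'I_u v R' cp cq); rewrite ?card_ord //.
by move=> p p' q q' ep eq /sub; apply: H.
Qed.

Lemma chain_coloringU (u v : nat) R R' :
  chain_coloring E u R -> chain_coloring E v R' ->
  chain_coloring E (u * v) (fun p q => R p q \/ R' p q).
Proof.
move=> [cp [cq H]] [cp' [cq' H']].
apply: (@chain_coloring_fin ('I_u * 'I_v)%type ('I_u * 'I_v)%type _ _
  (fun p => (cp p, cp' p)) (fun q => (cq q, cq' q))); rewrite ?card_prod ?card_ord //.
by move=> p p' q q' [e1 e2] [e3 e4] [r|r]; [apply: H|apply: H'].
Qed.

Lemma chain_coloring_cover (I : Type) (u : nat) (s : seq I) (F : I -> P -> Q -> Prop) :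
  (0 < u)%N -> (forall i, chain_coloring E u (F i)) ->
  chain_coloring E (u ^ size s) (fun p q => has (fun i => `[< F i p q >]) s).
Proof.
move=> u0 HF; elim: s => [|i s IH] /=.
  by exists (fun=> ord0), (fun=> ord0).
rewrite expnS; apply: chain_coloring_sub (leqnn _) _ (chain_coloringU (HF i) IH).
by move=> p q /orP[/asboolP|]; [left|right].
Qed.

(** One extra colour marks the vertices outside the rectangle, so a monochromatic 2K2 with an edge
    inside the rectangle lies inside it entirely. *)
Lemma chain_coloring_induced (A : {set P}) (B : {set Q}) (u : nat) :
  chain_coloring (@bip_induced P Q E A B) u (fun _ _ => True) ->
  chain_coloring E u.+1 (fun p q => p \in A /\ q \in B).
Proof.
move=> [cp [cq H]].
apply: (@chain_coloring_fin (option 'I_u) (option 'I_u) _ _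
  (fun p => omap cp (insub p)) (fun q => omap cq (insub q)));
  rewrite ?card_option ?card_ord //.
move=> p p' q q' ep eq [pA qB].
move: ep eq; rewrite (insubT (fun p => p \in A) pA) (insubT (fun q => q \in B) qB) /=.
case: insubP => //= p1 _ <- [ep]; case: insubP => //= q1 _ <- [eq] e1 e2.
exact: (H _ _ _ _ ep eq I e1 e2).
Qed.

Lemma chain_coloring_true (u : nat) :
  chain_coloring E u (fun _ _ => True) ->
  exists (Ps : 'I_u -> {set P}) (Qs : 'I_u -> {set Q}),
      [/\ is_partition Ps, is_partition Qs &
          forall i j, ~ has_induced_matching (@bip_induced P Q E (Ps i) (Qs j)) 2].
Proof.
move=> [cp [cq H]].
exists (fun i => [set p | cp p == i]%SET), (fun i => [set q | cq q == i]%SET); split.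
- move=> p; exists (cp p); split=> [|i]; first by rewrite inE.
  by rewrite inE => /eqP.
- move=> p; exists (cq p); split=> [|i]; first by rewrite inE.
  by rewrite inE => /eqP.
move=> i j [p [q [_ _ M]]].
have ep k : cp (val (p k)) = i by have := valP (p k); rewrite inE => /eqP.
have eq k : cq (val (q k)) = j by have := valP (q k); rewrite inE => /eqP.
have := H (val (p ord0)) (val (p ord_max)) (val (q ord0)) (val (q ord_max)).
rewrite !ep !eq => /(_ erefl erefl I).
have := M ord0 ord0; have := M ord_max ord_max; have := M ord0 ord_max.
by have := M ord_max ord0; rewrite /bip_induced /= => -> -> -> -> /(_ isT isT).
Qed.

End ChainColoring.

(** * Reduced pairs *)

(* If (a, b) is an edge (non-edge), an induced matching of G (of its bipartite
   complement) inside this rectangle can be enlarged by (a, b). *)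
Definition reduced (P Q : finType) (E : P -> Q -> bool) (a : P) (b : Q)
    (p : P) (q : Q) : bool :=
  (E p b != E a b) && (E a q != E a b).

Lemma induced_matching_extend (P Q : finType) (E : P -> Q -> bool) (a : P) (b : Q) (s : nat) :
  E a b ->
  has_induced_matching (@bip_induced P Q E [set p | ~~ E p b]%SET [set q | ~~ E a q]%SET) s ->
  has_induced_matching E s.+1.
Proof.
move=> ab [p [q [_ _ M]]].
apply: (@has_induced_matchingI _ _ _ _
  (fun i => if unlift ord0 i is Some j then val (p j) else a)
  (fun i => if unlift ord0 i is Some j then val (q j) else b)) => i j.
have hp k : E (val (p k)) b = false by have := valP (p k); rewrite inE => /negbTE.
have hq k : E a (val (q k)) = false by have := valP (q k); rewrite inE => /negbTE.
case: (unliftP ord0 i) => [i' ->|->]; case: (unliftP ord0 j) => [j' ->|->].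
- by rewrite [LHS]M (inj_eq lift_inj).
- by rewrite hp eq_sym (negbTE (neq_lift _ _)).
- by rewrite hq (negbTE (neq_lift _ _)).
by rewrite eqxx.
Qed.

Lemma has_induced_matching_le (P Q : finType) (E : P -> Q -> bool) (s t : nat) :
  (s <= t)%N -> has_induced_matching E t -> has_induced_matching E s.
Proof.
move=> st [p [q [_ _ M]]].
apply: (@has_induced_matchingI _ _ _ _
  (fun i => p (widen_ord st i)) (fun i => q (widen_ord st i))) => i j.
by rewrite M.
Qed.

Lemma induced_matching_sub (P Q : finType) (E : P -> Q -> bool) A B (s : nat) :
  has_induced_matching (@bip_induced P Q E A B) s -> has_induced_matching E s.
Proof.
move=> [p [q [_ _ M]]].
exact: (@has_induced_matchingI _ _ _ _ (fun i => val (p i)) (fun i => val (q i))) M.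
Qed.

Definition omits (P Q : finType) (E : P -> Q -> bool) (s t : nat) : Prop :=
  ~ has_induced_matching E s /\ ~ has_induced_matching (bip_compl E) t.

Lemma reduced_coloring (P Q : finType) (E : P -> Q -> bool) (s t u : nat) :
  (forall (P' Q' : finType) (E' : P' -> Q' -> bool),
     omits E' s t.+1 \/ omits E' s.+1 t -> chain_coloring E' u (fun _ _ => True)) ->
  omits E s.+1 t.+1 ->
  forall a b, chain_coloring E u.+1 (reduced E a b).
Proof.
move=> IH [ns nt] a b; case ab: (E a b).
- apply: (chain_coloring_sub (leqnn _) _ (@chain_coloring_induced _ _ E
    [set p | ~~ E p b]%SET [set q | ~~ E a q]%SET u _)).
    by move=> p q; rewrite /reduced ab !inE; case: (E p b); case: (E a q).
  apply: IH; left; split; first by move=> /(induced_matching_extend ab).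
  by move/(@induced_matching_sub _ _ (bip_compl E)).
(* For a non-edge it is the matching of the complement that gets extended, so [t] drops instead of
   [s]; the colouring still concerns [E]. *)
apply: (chain_coloring_sub (leqnn _) _ (@chain_coloring_induced _ _ E
    [set p | ~~ bip_compl E p b]%SET [set q | ~~ bip_compl E a q]%SET u _)).
  by move=> p q; rewrite /reduced ab !inE /bip_compl; case: (E p b); case: (E a q).
apply: IH; right; split; first by move/(@induced_matching_sub _ _ E).
by apply: contra_not nt => /(@induced_matching_extend _ _ (bip_compl E)); apply; rewrite /bip_compl ab.
Qed.

(* Take J minimal: each i in J then has a private t. *)
Lemma breadth (I T : finType) (X : I -> T -> bool) (S : {set I}) (d : nat) :
  (exists J : {set I}, [/\ J \subset S, (#|J| <= d)%N &
     forall t, (forall i, i \in J -> ~~ X i t) -> forall i, i \in S -> ~~ X i t]) \/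
  (exists (e : 'I_d -> I) (f : 'I_d -> T), forall i j, X (e i) (f j) = (i == j)).
Proof.
pose good (J : {set I}) := (J \subset S) &&
  [forall t, [forall i in J, ~~ X i t] ==> [forall i in S, ~~ X i t]].
have goodS : good S by rewrite /good subxx; apply/forallP => t; apply/implyP.
case: (minset_exists goodS) => J /minsetP[/andP[JS /forallP gJ] Jmin] _.
have [leJ|ltJ] := leqP #|J| d.
  left; exists J; split=> // t h i iS.
  have /implyP/(_ _)/forall_inP := gJ t; apply=> //.
  by apply/forall_inP.
right.
have priv i : i \in J -> exists t, forall j, j \in J -> X j t = (j == i).
  move=> iJ; have : ~~ good (J :\ i)%SET.
    apply/negP => g; have e := Jmin _ g (finset.subsetDl _ _).
    by move: iJ; rewrite -e !inE eqxx.
  rewrite /good (fintype.subset_trans (finset.subsetDl _ _) JS) /= negb_forall => /existsP[t].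
  rewrite negb_imply => /andP[/forall_inP h1 h2]; exists t => j jJ.
  have [->|ji] := eqVneq j i.
    apply/negP => /negP Xit; move/implyP: (gJ t) => g; case/negP: h2; apply: g.
    apply/forall_inP => k kJ; have [->//|ki] := eqVneq k i.
    by apply: h1; rewrite !inE ki.
  by apply/negbTE/h1; rewrite !inE ji.
have lt := ltnW ltJ.
pose e (k : 'I_d) : I := enum_val (widen_ord lt k).
have eJ k : e k \in J by exact: enum_valP.
have [f hf] := choice (fun k => priv (e k) (eJ k)).
exists e, f => i j; rewrite hf //.
by apply/eqP/eqP => [/enum_val_inj/(congr1 val)/= h|->//]; apply: val_inj.
Qed.

(** * Positions with respect to a longest half graph *)

Definition half_graph (P Q : finType) (E : P -> Q -> bool) (n : nat)
    (a : nat -> P) (b : nat -> Q) : Prop :=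
  forall i j, (0 < i <= n)%N -> (0 < j <= n)%N -> E (a i) (b j) = (i <= j)%N.

Lemma half_graph_bound (P Q : finType) (E : P -> Q -> bool) n a b :
  half_graph E n a b -> (n <= #|P|)%N.
Proof.
move=> hg; rewrite -[n]card_ord -(@card_codom _ _ (fun i : 'I_n => a i.+1)) ?max_card //.
move=> i j /= ij; apply: val_inj => /=.
have := hg i.+1 j.+1; have := hg j.+1 i.+1; have := hg i.+1 i.+1; have := hg j.+1 j.+1.
rewrite ij; have := ltn_ord i; have := ltn_ord j; lia.
Qed.

Lemma maximal_half_graph (P Q : finType) (E : P -> Q -> bool) (p0 : P) (q0 : Q) :
  exists n a b, half_graph E n a b /\ forall a' b', ~ half_graph E n.+1 a' b'.
Proof.
have ex : exists n, `[< exists a b, half_graph E n a b >].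
  by exists 0%N; apply/asboolP; exists (fun=> p0), (fun=> q0) => i j; lia.
have bd n : `[< exists a b, half_graph E n a b >] -> (n <= #|P|)%N.
  by move=> /asboolP[a [b]]; exact: half_graph_bound.
case: (ex_maxnP ex bd) => n /asboolP[a [b hg]] nmax; exists n, a, b; split=> // a' b' hg'.
by have := nmax n.+1; rewrite ltnn => h; apply: notF; apply: h; apply/asboolP; exists a', b'.
Qed.

Section Cuts.
Variables (P Q : finType) (E : P -> Q -> bool) (n : nat) (a : nat -> P) (b : nat -> Q).
Hypothesis hg : half_graph E n a b.

(* Out of range, b_0 has no neighbour and b_j is adjacent to everything for
   j > n; dually a_0 is adjacent to everything and a_i to nothing for i > n. *)
Definition row_bit (j : nat) (p : P) : bool :=
  if j == 0%N then false else if (j <= n)%N then E p (b j) else true.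

Definition col_bit (i : nat) (q : Q) : bool :=
  if i == 0%N then true else if (i <= n)%N then E (a i) q else false.

Local Notation x := row_bit.
Local Notation y := col_bit.

Lemma row_bit_a i j : (0 < i <= n)%N -> x j (a i) = (i <= j)%N.
Proof.
move=> i0; rewrite /row_bit; case: eqVneq => [->|j0]; first lia.
by case: leqP => [jn|]; [rewrite hg//; lia|lia].
Qed.

Lemma col_bit_b i j : (0 < j <= n)%N -> y i (b j) = (i <= j)%N.
Proof.
move=> j0; rewrite /col_bit; case: eqVneq => [->|i0]; first lia.
by case: leqP => [jn|]; [rewrite hg//; lia|lia].
Qed.

Definition bit_reduced (i j : nat) (p : P) (q : Q) : bool :=
  (x j p != (i <= j)%N) && (y i q != (i <= j)%N).

(** The shift to [m.+1] leaves [y j q] free. At a cut [j] the bit [x j p] then selects a side: if it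
    is false, non-reduction by [(j, j)] makes [y j q] true; if it is true, non-reduction by
    [(j.+1, j)] makes [y j.+1 q] false. *)
Definition between (i j : nat) (p : P) (q : Q) : Prop :=
  [/\ forall m, (m <= i)%N -> x m p = false, forall m, (j <= m)%N -> x m p = true,
      forall m, (m <= i)%N -> y m q = true & forall m, (j <= m)%N -> y m.+1 q = false].

Lemma bit_reduced_coloring v : (0 < v)%N ->
  (forall a b, chain_coloring E v (reduced E a b)) ->
  forall i j, chain_coloring E v (bit_reduced i j).
Proof.
move=> v0 red i j.
have [/andP[i0 j0]|out] := boolP ((0 < i <= n) && (0 < j <= n))%N.
  apply: (chain_coloring_sub (leqnn v) _ (red (a i) (b j))) => p q.
  rewrite /bit_reduced /reduced /row_bit /col_bit hg //.
  case/andP: i0 => /lt0n_neq0/negbTE -> ->.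
  by case/andP: j0 => /lt0n_neq0/negbTE -> ->; apply.
(* Out of range, one of the two conventional bits agrees with [(i <= j)], so no pair is reduced and
   any colouring will do. *)
apply: (chain_coloring_sub (leqnn v) _ (red (a 0%N) (b 0%N))) => p q.
suff -> : bit_reduced i j p q = false by [].
rewrite /bit_reduced /row_bit /col_bit; move: out.
case: i => [|i]; first by rewrite andbF.
case: j => [|j] //=; case: (leqP i.+1 n) => // ni; case: (leqP j.+1 n) => // nj _.
- by have -> : (i < j.+1)%N = true by lia.
- by rewrite ltnNge (leq_trans nj ni) andbF.
by case: ltnP.
Qed.

Hypothesis hmax : forall a' b', ~ half_graph E n.+1 a' b'.

(* Otherwise (p, q) could be inserted into the half graph. *)
Lemma between_consecutive i p q : (i <= n)%N -> between i i.+1 p q -> E p q = y i.+1 q.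
Proof.
move=> le_in [x0 x1 y1 y0].
have xb m : (0 < m <= n)%N -> E p (b m) = (i < m)%N.
  move=> mn; case: (leqP m i) => im; [have := x0 _ im|have := x1 _ im];
  rewrite /row_bit; case/andP: mn => /lt0n_neq0/negbTE -> -> -> //.
have ya m : (0 < m <= n)%N -> m != i.+1 -> E (a m) q = (m <= i)%N.
  move=> mn; case: (leqP m i) => im mi; [have := y1 _ im|have := y0 m.-1];
  rewrite /col_bit ?prednK; case/andP: mn => m0 mn //; rewrite ?mn (negbTE (lt0n_neq0 m0)).
    by move=> ->.
  by move=> ->//; lia.
case Ey: (y i.+1 q); case Epq: (E p q) => //; exfalso.
  have ltn : (i < n)%N by move: Ey; rewrite /col_bit /=; case: leqP.
  have ya' : E (a i.+1) q by move: Ey; rewrite /col_bit ltn.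
  (* Here [a i.+1] is adjacent to [q]: insert [p] just after [a i.+1] and [q] just before [b i.+1],
     so that [p] comes after [q], as the non-edge requires. *)
  apply: (hmax (a' := fun m => if (m <= i.+1)%N then a m else if m == i.+2 then p else a m.-1)
    (b' := fun m => if (m <= i)%N then b m else if m == i.+1 then q else b m.-1)).
  move=> k l kn ln; case: (leqP k i.+1) => ki; last case: (eqVneq k i.+2) => ki2;
    (case: (leqP l i) => li; last case: (eqVneq l i.+1) => li2).
  + rewrite hg//; lia.
  + case: (eqVneq k i.+1) => [->|ne]; [rewrite ya' li2; lia|rewrite ya; lia].
  + rewrite hg; lia.
  + rewrite xb; lia.
  + rewrite Epq; lia.
  + rewrite xb; lia.
  + rewrite hg; lia.
  + rewrite ya; lia.
  + rewrite hg; lia.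
have ya' : (i < n)%N -> E (a i.+1) q = false by move: Ey; rewrite /col_bit /=; case: leqP.
have {}ya m : (0 < m <= n)%N -> E (a m) q = (m <= i)%N.
  by move=> mn; case: (eqVneq m i.+1) => [mi|ne]; [rewrite mi ya'; lia|exact: ya].
(* Here [p] and [q] are adjacent and both take place [i.+1]. *)
apply: (hmax (a' := fun m => if (m <= i)%N then a m else if m == i.+1 then p else a m.-1)
  (b' := fun m => if (m <= i)%N then b m else if m == i.+1 then q else b m.-1)).
move=> k l kn ln; case: (leqP k i) => ki; last case: (eqVneq k i.+1) => ki2;
  (case: (leqP l i) => li; last case: (eqVneq l i.+1) => li2).
+ rewrite hg//; lia.
+ rewrite ya; lia.
+ rewrite hg; lia.
+ rewrite xb; lia.
+ rewrite Epq; lia.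
+ rewrite xb; lia.
+ rewrite hg; lia.
+ rewrite ya; lia.
+ rewrite hg; lia.
Qed.

(** Adjacency to [q] is the same for all [p] whose bits switch between [i] and [i.+1]. Colouring [P]
    by this property turns the edge [p q] into the edge [p' q]. *)
Lemma between_consecutive_coloring i : (i <= n)%N -> chain_coloring E 2 (between i i.+1).
Proof.
move=> le_in.
apply: (@chain_coloring_fin _ _ _ bool unit _ _
  (fun p => `[< (forall m, (m <= i)%N -> x m p = false) /\ forall m, (i.+1 <= m)%N -> x m p = true >])
  (fun=> tt)); rewrite ?card_bool ?card_unit //.
move=> p p' q q' ep _ bt; rewrite (between_consecutive le_in bt) => yq _.
case: bt => x0 x1 y1 y0; apply/orP; right.
have /asboolP[x0' x1'] : `[< (forall m, (m <= i)%N -> x m p' = false) /\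
    forall m, (i.+1 <= m)%N -> x m p' = true >] by rewrite -ep; apply/asboolP.
by rewrite (@between_consecutive i).
Qed.

End Cuts.

(** * Test sets for the side of a cut *)

Lemma breadth_nat (T : finType) (X : nat -> T -> bool) (lo hi d : nat) :
  (exists W : seq nat, [/\ (size W <= d)%N, forall m, m \in W -> (lo <= m <= hi)%N &
     forall t, (forall m, m \in W -> ~~ X m t) -> forall m, (lo <= m <= hi)%N -> ~~ X m t]) \/
  (exists (e : 'I_d -> nat) (f : 'I_d -> T), forall i j, X (e i) (f j) = (i == j)).
Proof.
case: (breadth (fun i : 'I_hi.+1 => X i) [set i : 'I_hi.+1 | (lo <= i)%N]%SET d); last first.
  by move=> [e [f M]]; right; exists (fun i => val (e i)), f.
move=> [J [JS leJ H]]; left; exists [seq val i | i <- enum J]; split.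
- by rewrite size_map -cardE.
- move=> m /mapP[i]; rewrite mem_enum => /(fintype.subsetP JS); rewrite inE => lo_i ->.
  by rewrite lo_i -ltnS ltn_ord.
move=> t h m /andP[lo_m]; rewrite -ltnS => m_hi.
apply: (H t _ (Ordinal m_hi)); last by rewrite inE.
by move=> i iJ; apply: h; apply/mapP; exists i => //; rewrite mem_enum.
Qed.

Section Glue.
Variables (P Q : finType) (E : P -> Q -> bool) (n : nat) (a : nat -> P) (b : nat -> Q).
Local Notation x := (row_bit E n b).
Local Notation y := (col_bit E n a).

(** Four uses of the breadth dichotomy, for [p] and for [q], before and after the cut; the
    alternative is each time an induced matching of size [d] in the graph or its complement. The
    index [j] itself is added, whence [4 * d + 1]. *)
Lemma cut_test_set d j : omits E d d -> (0 < j <= n)%N ->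
  exists W : seq nat, [/\ (size W <= 4 * d + 1)%N, j \in W,
   forall p, (forall m, m \in W -> (m <= j)%N -> x m p = false) ->
     forall m, (m <= j)%N -> x m p = false,
   forall p, (forall m, m \in W -> (j <= m)%N -> x m p = true) ->
     forall m, (j <= m)%N -> x m p = true &
   (forall q, (forall m, m \in W -> (m <= j)%N -> y m q = true) ->
     forall m, (m <= j)%N -> y m q = true) /\
   (forall q, (forall m, m \in W -> (j <= m)%N -> y m.+1 q = false) ->
     forall m, (j <= m)%N -> y m.+1 q = false)].
Proof.
move=> [noE noC] j0.
have [[W1 [s1 r1 H1]]|[e [f M]]] := breadth_nat (fun m p => E p (b m)) 1 j d; last first.
  case: noE; apply: (@has_induced_matchingI _ _ _ _ f (fun i => b (e i))) => i k.
  by rewrite M eq_sym.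
have [[W2 [s2 r2 H2]]|[e [f M]]] := breadth_nat (fun m p => ~~ E p (b m)) j n d; last first.
  case: noC; apply: (@has_induced_matchingI _ _ _ _ f (fun i => b (e i))) => i k.
  by rewrite /bip_compl M eq_sym.
have [[W3 [s3 r3 H3]]|[e [f M]]] := breadth_nat (fun m q => ~~ E (a m) q) 1 j d; last first.
  by case: noC; apply: (@has_induced_matchingI _ _ _ _ (fun i => a (e i)) f).
have [[W4 [s4 r4 H4]]|[e [f M]]] := breadth_nat (fun m q => E (a m) q) j.+1 n d; last first.
  by case: noE; apply: (@has_induced_matchingI _ _ _ _ (fun i => a (e i)) f).
have xE m p : (0 < m <= n)%N -> x m p = E p (b m).
  by case/andP => /lt0n_neq0/negbTE m0 mn; rewrite /row_bit m0 mn.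
have yE m q : (0 < m <= n)%N -> y m q = E (a m) q.
  by case/andP => /lt0n_neq0/negbTE m0 mn; rewrite /col_bit m0 mn.
(* [W4] tests [y m], whereas the condition on [q] after the cut reads [y m.+1]; hence the
   predecessors. *)
exists (j :: W1 ++ W2 ++ W3 ++ [seq m.-1 | m <- W4]); split.
- by rewrite /= !size_cat size_map; lia.
- by rewrite mem_head.
- move=> p h m mj; have [->//|m0] := eqVneq m 0%N.
  rewrite xE; last lia.
  apply/negbTE/H1; last lia.
  move=> k kW; have := r1 _ kW => kj; rewrite -xE; last lia.
  by rewrite h ?inE ?mem_cat ?kW ?orbT //; lia.
- move=> p h m jm; have [mn|nm] := leqP m n; last first.
    by rewrite /row_bit; case: eqVneq => [|_]; [lia|rewrite leqNgt nm].
  rewrite xE; last lia.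
  apply/negPn/H2; last lia.
  move=> k kW; have := r2 _ kW => kj; rewrite -xE; last lia.
  by rewrite h ?inE ?mem_cat ?kW ?orbT //; lia.
split.
- move=> q h m mj; have [->//|m0] := eqVneq m 0%N.
  rewrite yE; last lia.
  apply/negPn/H3; last lia.
  move=> k kW; have := r3 _ kW => kj; rewrite -yE; last lia.
  by rewrite h ?inE ?mem_cat ?kW ?orbT //; lia.
- move=> q h m jm; have [mn|nm] := ltnP m n; last first.
    by rewrite /col_bit /= ltnNge nm.
  rewrite yE; last lia.
  apply/negbTE/H4; last lia.
  move=> k kW; have := r4 _ kW => kj; rewrite -yE; last lia.
  have -> : k = k.-1.+1 by lia.
  have kW' : k.-1 \in [seq m.-1 | m <- W4] by apply: map_f.
  by rewrite h ?inE ?mem_cat ?kW' ?orbT //; lia.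
Qed.

(* A pair not reduced by the vertices of the test set passes the cut at j
   entirely on one side. *)
Lemma glue_between d v u u' i j l :
  omits E d d -> (0 < u)%N -> (0 < u')%N -> (0 < v)%N ->
  (forall i j, chain_coloring E v (bit_reduced E n a b i j)) ->
  (i <= j <= l)%N ->
  chain_coloring E u (between E n a b i j) ->
  chain_coloring E u' (between E n a b j l) ->
  chain_coloring E (v ^ (4 * (4 * d + 1)) * (u * u')) (between E n a b i l).
Proof.
move=> om u0 u'0 v0 red ijl cu cu'.
have vk k : (0 < v ^ k)%N by rewrite expn_gt0 v0.
have [j0|] := posnP j.
  have -> : i = j by lia.
  by apply: chain_coloring_sub cu' => //; rewrite mulnA leq_pmull // muln_gt0 vk.
have [jn j0|nj _] := leqP j n; last first.
  apply: chain_coloring_sub cu => [|p q [x0 _ y1 _]].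
    by rewrite mulnCA leq_pmulr // muln_gt0 vk.
  split=> // m jm; rewrite /row_bit /col_bit /=.
    by case: eqVneq => [|_]; [lia|rewrite leqNgt (leq_trans nj jm)].
  by rewrite ltnNge (leq_trans (ltnW nj) jm).
have [W [sW jW Wx0 Wx1 [Wy1 Wy0]]] := cut_test_set om (introT andP (conj j0 jn)).
(* Pairs on the diagonal and just below it transfer bits between [p] and [q] at the same test index;
   the pairs with [j] and [j.+1] carry information from the cut to the test indices. *)
pose s := [seq (m, m) | m <- W] ++ [seq (m.+1, m) | m <- W] ++
  [seq (m.+1, j) | m <- W] ++ [seq (j.+1, m) | m <- W].
have ss : (size s <= 4 * (4 * d + 1))%N by rewrite !size_cat !size_map; lia.
have := chain_coloringU (chain_coloring_cover s
  v0 (fun ij => red ij.1 ij.2)) (chain_coloringU cu cu').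
apply: chain_coloring_sub => [|p q [x0 x1 y1 y0]].
  by rewrite leq_pmul2r ?muln_gt0 ?u0 // leq_pexp2l.
case hs: has; [by left|right].
have nr k k' : (k, k') \in s -> bit_reduced E n a b k k' p q = false.
  move=> ks; apply/negbTE/negP => r; move/negbT: hs => /hasPn/(_ _ ks)/asboolP; exact.
have nr1 m : m \in W -> bit_reduced E n a b m m p q = false.
  by move=> mW; apply: nr; rewrite !mem_cat; apply/orP; left; apply/mapP; exists m.
have nr2 m : m \in W -> bit_reduced E n a b m.+1 m p q = false.
  by move=> mW; apply: nr; rewrite !mem_cat; apply/or4P/Or42/mapP; exists m.
have nr3 m : m \in W -> bit_reduced E n a b m.+1 j p q = false.
  by move=> mW; apply: nr; rewrite !mem_cat; apply/or4P/Or43/mapP; exists m.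
have nr4 m : m \in W -> bit_reduced E n a b j.+1 m p q = false.
  by move=> mW; apply: nr; rewrite !mem_cat; apply/or4P/Or44/mapP; exists m.
case xj: (x j p); [left|right].
- have yj : y j.+1 q = false.
    by have := nr2 _ jW; rewrite /bit_reduced xj ltnn /= => /negbFE/eqP.
  have xW m : m \in W -> (j <= m)%N -> x m p = true.
    move=> mW; rewrite leq_eqVlt => /predU1P[<-//|jm].
    by have := nr4 _ mW; rewrite /bit_reduced yj jm andbT => /negbFE/eqP.
  split=> //; first exact: Wx1.
  apply: Wy0 => m mW jm.
  by have := nr2 _ mW; rewrite /bit_reduced xW // ltnn /= => /negbFE/eqP.
- have yj : y j q = true.
    by have := nr1 _ jW; rewrite /bit_reduced xj leqnn /= => /negbFE/eqP.
  have xW m : m \in W -> (m <= j)%N -> x m p = false.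
    move=> mW; rewrite leq_eqVlt => /predU1P[->//|mj]; apply/negbTE/negP => xm.
    have := nr2 _ mW; rewrite /bit_reduced xm ltnn /= => /negbFE/eqP ym.
    by have := nr3 _ mW; rewrite /bit_reduced xj ym mj.
  split=> //; first exact: Wx0.
  apply: Wy1 => m mW mj.
  by have := nr1 _ mW; rewrite /bit_reduced xW // leqnn /= => /negbFE/eqP.
Qed.

End Glue.

(** * Greedy cuts and the induction step *)

(** Layers are coloured with period [2 * r]. Edges go back by less than [r] layers, so two edges
    starting in different layers of the same residue have a cross pair at least [r] layers forward,
    which is an edge. Otherwise both edges start in one layer, and its own colouring applies. *)
Lemma chain_coloring_layers (P Q : finType) (E : P -> Q -> bool)
    (f : P -> nat) (g : Q -> nat) (r u : nat) :
  (0 < r)%N ->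
  (forall p q, (f p + r <= g q)%N -> E p q) ->
  (forall p q, (g q + r <= f p)%N -> E p q = false) ->
  (forall k, chain_coloring E u
     (fun p q => [/\ f p = k, (k < g q + r)%N & (g q < k + r)%N])) ->
  chain_coloring E (2 * r * u ^ (2 * r)) (fun _ _ => True).
Proof.
move=> r0 far1 far2 /choice[cp /choice[cq H]].
have r2 : (0 < 2 * r)%N by rewrite muln_gt0.
(* A vertex [q] meets up to [2 * r] windows and records its colour in each, with [e] encoding the
   layer [g q + e - r]; a vertex [p] only needs the window of its own layer. *)
apply: (@chain_coloring_fin _ _ _ ('I_(2 * r) * 'I_u)%type
   ('I_(2 * r) * {ffun 'I_(2 * r) -> 'I_u})%type _ _
   (fun p => (Ordinal (ltn_pmod (f p) r2), cp (f p) p))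
   (fun q => (Ordinal (ltn_pmod (g q) r2), [ffun e : 'I_(2 * r) => cq (g q + e - r)%N q]))).
- rewrite card_prod !card_ord leq_mul2l; apply/orP; right.
  by case: (u) => // u'; rewrite -[leqLHS]expn1 leq_pexp2l.
- by rewrite card_prod card_ffun !card_ord.
move=> p p' q q' [fe ce] [ge /ffunP he] _ Epq Epq'; apply/orP.
have lt1 : (f p < g q + r)%N by rewrite ltnNge; apply/negP => /far2; rewrite Epq.
have lt2 : (f p' < g q' + r)%N by rewrite ltnNge; apply/negP => /far2; rewrite Epq'.
have modr m1 m2 : m1 = m2 %[mod 2 * r] -> (m1 < m2)%N -> (m1 + 2 * r <= m2)%N.
  move=> em lt; have /eqP := em; rewrite eq_sym eqn_mod_dvd; last exact: ltnW.
  by move=> /dvdn_leq; rewrite subn_gt0 lt => /(_ isT); lia.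
have [lf|lf|ef] := ltngtP (f p) (f p').
- by left; apply: far1; have := modr _ _ fe lf; lia.
- by right; apply: far1; have := modr _ _ (esym fe) lf; lia.
have [gq|gq] := leqP (f p + r) (g q); first by right; apply: far1; rewrite -ef.
have [gq'|gq'] := leqP (f p + r) (g q'); first by left; apply: far1.
have eg : g q = g q'.
  by have [lg|lg|//] := ltngtP (g q) (g q');
     [have := modr _ _ ge lg|have := modr _ _ (esym ge) lg]; lia.
have e_lt : (f p + r - g q < 2 * r)%N by lia.
have := he (Ordinal e_lt); rewrite !ffunE /= -eg subnKC; last lia.
rewrite addnK => eq; move: ce; rewrite -ef => ce.
by apply/orP; apply: (H (f p) p p' q q').
Qed.

Lemma ex_least (R : nat -> Prop) : (exists k, R k) ->
  exists k, R k /\ forall k', (k' < k)%N -> ~ R k'.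
Proof.
move=> [k0 Rk0]; have ex : exists k, `[< R k >] by exists k0; apply/asboolP.
case: (ex_minnP ex) => k /asboolP Rk kmin; exists k; split=> // k' lt Rk'.
by have := kmin k' (introT (asboolP _) Rk'); rewrite leqNgt lt.
Qed.

Lemma greedy_cuts (N : nat) (D : nat -> nat -> Prop) :
  (forall i, (i < N)%N -> D i i.+1) ->
  exists c : nat -> nat, [/\ c 0%N = 0%N, forall k, (c k <= N)%N,
    forall k, (c k <= c k.+1)%N,
    forall k, (c k < N)%N -> (c k < c k.+1)%N /\ D (c k) (c k.+1) &
    forall k j, (c k.+1 < j <= N)%N -> ~ D (c k) j].
Proof.
move=> D1.
have [i|reach hr] := choice (fun i => _ : exists j,
  ((i <= N)%N -> [/\ (i <= j <= N)%N, (i < N)%N -> (i < j)%N /\ D i j &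
     forall j', (j < j' <= N)%N -> ~ D i j'])).
  have [iN|] := ltnP i N; last by exists i => ?; split; lia.
  have ex : exists j, (i < j <= N)%N && `[< D i j >].
    by exists i.+1; rewrite ltnSn iN; apply/asboolP/D1.
  have bd j : (i < j <= N)%N && `[< D i j >] -> (j <= N)%N by case/andP => /andP[].
  case: (ex_maxnP ex bd) => j /andP[ij /asboolP Dij jmax]; exists j => _; split; [lia|by split; [lia|]|].
  move=> j' jj' Dj'; have := jmax j'; rewrite (introT (asboolP _) Dj') andbT; lia.
pose c k := iter k reach 0%N.
have cN k : (c k <= N)%N by elim: k => //= k IH; case: (hr _ IH) => /andP[].
exists c; split=> // k.
- by case: (hr _ (cN k)) => /andP[].
- by move=> lt; case: (hr _ (cN k)) => _ /(_ lt).
- by move=> j jN; case: (hr _ (cN k)) => _ _; apply.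
Qed.

(** * Pairs that contradict their positions *)

Section Defects.
Variables (P Q : finType) (E : P -> Q -> bool) (n : nat) (a : nat -> P) (b : nat -> Q).
Local Notation x := (row_bit E n b).
Local Notation y := (col_bit E n a).

Lemma row_bitE j p : (0 < j <= n)%N -> x j p = E p (b j).
Proof. by case/andP => /lt0n_neq0/negbTE j0 jn; rewrite /row_bit j0 jn. Qed.

Lemma col_bitE i q : (0 < i <= n)%N -> y i q = E (a i) q.
Proof. by case/andP => /lt0n_neq0/negbTE i0 jn; rewrite /col_bit i0 jn. Qed.

Lemma row_bit_gt j p : (n < j)%N -> x j p = true.
Proof. by move=> nj; rewrite /row_bit; case: eqVneq => [|_]; [lia|rewrite leqNgt nj]. Qed.

Lemma col_bit_gt i q : (n < i)%N -> y i q = false.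
Proof. by move=> ni; rewrite /col_bit; case: eqVneq => [|_]; [lia|rewrite leqNgt ni]. Qed.

Variable v : nat.
Hypothesis v0 : (0 < v)%N.
Hypothesis red : forall a b, chain_coloring E v (reduced E a b).

(** For [(p, q)] in the stretch, [p] misses [b i'] and [q] misses [a j.+1]. If [p0 q] is a non-edge,
    [(p0, b i')] reduces the pair; if [p q0] is one, [(a j.+1, q0)] does; if both are edges,
    [(p0, q0)] does. *)
Lemma non_edge_defect i' i j p0 q0 : (i' <= i < j)%N ->
  E p0 q0 = false -> x i' p0 = true -> y j.+1 q0 = true ->
  chain_coloring E (v ^ 3) (between E n a b i j).
Proof.
move=> ij E0 xp yq.
have jn : (j < n)%N by case: ltnP => // nj; rewrite col_bit_gt in yq.
have i0 : (0 < i')%N by case: (i') xp.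
apply: (chain_coloring_sub (leqnn _) _ (chain_coloring_cover
  [:: (p0, q0); (p0, b i'); (a j.+1, q0)] v0 (fun ab => red ab.1 ab.2))) => p q [x0 _ _ y1].
have := x0 i'; have := y1 j (leqnn _); move: xp yq.
rewrite !row_bitE ?col_bitE; try lia.
move=> /= h1 h2 h3 /(_ _) h4.
have {}h4 : E p (b i') = false by apply: h4; lia.
rewrite /= !asboolb /reduced /= E0 h1 h2 h3 h4.
by case: (E p q0); case: (E p0 q).
Qed.

(** Dual argument, with the non-edges [(p0, b j)] and [(a i', q0)]. *)
Lemma edge_defect i' i j p0 q0 : (i' <= i < j)%N ->
  E p0 q0 = true -> x j p0 = false -> y i' q0 = false ->
  chain_coloring E (v ^ 3) (between E n a b i j).
Proof.
move=> ij E0 xp yq.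
have jn : (j <= n)%N by case: leqP => // nj; rewrite row_bit_gt in xp.
have i0 : (0 < i')%N by case: (i') yq.
apply: (chain_coloring_sub (leqnn _) _ (chain_coloring_cover
  [:: (p0, q0); (p0, b j); (a i', q0)] v0 (fun ab => red ab.1 ab.2))) => p q [_ x1 y0 _].
have := x1 j (leqnn _); have := y0 i'; move: xp yq.
rewrite !row_bitE ?col_bitE; try lia.
move=> /= h1 h2 /(_ _) h3 h4.
have {}h3 : E (a i') q = true by apply: h3; lia.
rewrite /= !asboolb /reduced /= E0 h1 h2 h3 h4.
by case: (E p q0); case: (E p0 q).
Qed.

End Defects.

(** A stretch costs [v ^ 3] colours, as many as a defect provides, and each gluing
    [v ^ (4 * (4 * d + 1))]. Windows have eleven stretches, and layers five apart are far. *)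
Lemma reduced_chain_coloring (P Q : finType) (E : P -> Q -> bool) (d v : nat) :
  omits E d d -> (1 < v)%N -> (forall a b, chain_coloring E v (reduced E a b)) ->
  chain_coloring E (2 * 5 * ((v ^ (4 * (4 * d + 1)) * v ^ 3) ^ 11) ^ (2 * 5))
    (fun _ _ => True).
Proof.
move=> om v1 red; have v0 := ltnW v1.
have [p0 _|P0] := pickP P; last first.
  apply: (@chain_coloring_fin _ _ _ unit unit _ _ (fun=> tt) (fun=> tt));
    rewrite ?card_unit ?muln_gt0 ?expn_gt0 ?muln_gt0 ?expn_gt0 ?v0 //.
  by move=> p; have := P0 p.
have [q0 _|Q0] := pickP Q; last first.
  apply: (@chain_coloring_fin _ _ _ unit unit _ _ (fun=> tt) (fun=> tt));
    rewrite ?card_unit ?muln_gt0 ?expn_gt0 ?muln_gt0 ?expn_gt0 ?v0 //.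
  by move=> p p' q; have := Q0 q.
have [n [a [b [hg hmax]]]] := maximal_half_graph E p0 q0.
pose x := row_bit E n b; pose y := col_bit E n a.
have red' := bit_reduced_coloring hg v0 red.
have v3 : (0 < v ^ 3)%N by rewrite expn_gt0 v0.
have [i|c [c0 cN cS cD cmax]] := @greedy_cuts n.+1
    (fun i j => chain_coloring E (v ^ 3) (between E n a b i j)).
  rewrite ltnS => /(between_consecutive_coloring hg hmax).
  by apply: chain_coloring_sub => //; rewrite (leq_trans v1) // -{1}[v]expn1 leq_pexp2l.
have cM k l : (k <= l)%N -> (c k <= c l)%N.
  by move=> /subnK <-; elim: (l - k)%N => //= r IH; exact: leq_trans IH (cS _).
have cL k l : (k < l)%N -> (c l <= n)%N -> (c k < c l)%N.
  move=> kl cl; have [|lt _] := cD k; first by have := cM _ _ (ltnW kl); lia.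
  exact: leq_trans lt (cM _ _ kl).
have cn : exists k, c k = n.+1.
  suff h k : (minn k n.+1 <= c k)%N.
    by exists n.+1; apply/eqP; rewrite eqn_leq cN /=; have := h n.+1; rewrite minnn.
  elim: k => [|k IH]; first by rewrite min0n.
  have := cS k; have := cN k; case: (ltnP (c k) n.+1) => [/cD[] |]; lia.
(* A violation would be a defect that colours a stretch from [c k] beyond [c k.+1], against the
   greedy choice. [F4] is dual. *)
have F3 k i j p q : (i <= c k)%N -> (c k.+1 < j)%N -> x i p = true ->
    y j.+1 q = true -> E p q = true.
  move=> ic cj xp yq; case Epq: (E p q) => //; exfalso.
  have jn : (j < n)%N by case: ltnP => // nj; rewrite /y col_bit_gt in yq.
  have cj' : (c k.+1 < j <= n.+1)%N by lia.
  apply: (cmax k j cj'); apply: (non_edge_defect v0 red _ Epq xp yq).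
  by have := cS k; lia.
have F4 k i j p q : (i <= c k)%N -> (c k.+1 < j)%N -> x j p = false ->
    y i q = false -> E p q = false.
  move=> ic cj xp yq; case Epq: (E p q) => //; exfalso.
  have jn : (j <= n)%N by case: leqP => // nj; rewrite /x row_bit_gt in xp.
  have cj' : (c k.+1 < j <= n.+1)%N by lia.
  apply: (cmax k j cj'); apply: (edge_defect v0 red _ Epq xp yq).
  by have := cS k; lia.
(* The bits of a vertex need not be monotone: the layer of [p] is read off its first true bit, that
   of [q] off its last true bit. *)
have [p|f hf] := choice (fun p => @ex_least (fun k => exists2 i, (i <= c k)%N & x i p) _).
  by have [k ck] := cn; exists k, n.+1; rewrite ?ck // /x row_bit_gt.
have [q|g hgq] := choice (fun q => @ex_least
    (fun k => forall j, (c k < j)%N -> y j.+1 q = false) _).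
  by have [k ck] := cn; exists k => j; rewrite ck => nj; rewrite /y col_bit_gt //; lia.
have A2 p k i : (k < f p)%N -> (i <= c k)%N -> x i p = false.
  move=> /(proj2 (hf p)) h ic; apply/negbTE/negP => xp; apply: h; by exists i.
have B1 q j : (c (g q) < j)%N -> y j.+1 q = false by exact: (proj1 (hgq q)).
have B2 q k : (k < g q)%N -> exists2 j, (c k < j)%N & y j.+1 q = true.
  move=> /(proj2 (hgq q)) h; apply: contra_notP h => h j cj.
  by apply/negbTE/negP => yq; apply: h; exists j.
apply: (@chain_coloring_layers _ _ E f g 5) => //.
- move=> p q fg; have [[i ic xp] _] := hf p.
  have [|j cj yq] := B2 q (g q).-1; first lia.
  apply: (F3 (f p) i j) => //; apply: leq_ltn_trans cj; apply: cM; lia.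
- move=> p q gf; have xp : x (c (f p).-1) p = false by apply: (A2 p (f p).-1) => //; lia.
  have cn' : (c (f p).-1 <= n)%N by case: leqP => // nc; rewrite /x row_bit_gt in xp.
  have cs k : (k < (f p).-1)%N -> (c k < c k.+1)%N.
    by move=> kf; apply: cL => //; apply: leq_trans (cM _ _ kf) cn'.
  have h0 := cs (g q); have h1 := cs (g q).+1; have h2 := cs (g q).+2.
  have h3 := cs (g q).+3; have h4 : (c (g q).+4 <= c (f p).-1)%N by apply: cM; lia.
  (* [B1] is shifted by one index, so two strict increases of the cuts are spent to get from
     [c (g q)] to below [c (g q).+2 - 1]. *)
  apply: (F4 (g q).+2 (c (g q).+2) (c (f p).-1)) => //; first lia.
  have -> : c (g q).+2 = (c (g q).+2).-1.+1 by lia.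
  apply: B1; lia.
move=> k; have window m r : chain_coloring E ((v ^ (4 * (4 * d + 1)) * v ^ 3) ^ r)
    (between E n a b (c m) (c (m + r)%N)).
  elim: r => [|r IH].
    rewrite addn0 expn0; exists (fun=> ord0), (fun=> ord0) => p p' q q' _ _ [h1 h2 _ _].
    by have := h1 _ (leqnn _); rewrite h2.
  rewrite (addnS m r) expnS; have [lt|ge] := ltnP (c (m + r)%N) n.+1; last first.
    have -> : c (m + r).+1 = c (m + r)%N by have := cS (m + r)%N; have := cN (m + r).+1; lia.
    apply: chain_coloring_sub IH => //.
    by rewrite leq_pmull // muln_gt0 v3 expn_gt0 v0.
  have [_ cu] := cD _ lt.
  apply: chain_coloring_sub (glue_between om _ v3 v0 red' _ IH cu) => //.
  - by rewrite mulnA mulnAC.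
  - by rewrite expn_gt0 muln_gt0 v3 expn_gt0 v0.
  by rewrite cS cM // leq_addr.
(* The window reaches from cut [k - 6], truncated at 0, to at least cut [k + 5]; at cut 0 the bits
   are fixed by convention. *)
apply: chain_coloring_sub (window (k - 6)%N 11%N) => // p q [fk kg gk].
have lo_m : (k - 6 < k)%N \/ k = 0%N by lia.
set h := (k - 6 + 11)%N; have kh : (k + 5 <= h)%N by rewrite /h; lia.
split=> m cm.
- by case: lo_m => [lt|k0]; [apply: (A2 p (k - 6)%N) => //; rewrite fk|
    move: cm; rewrite k0 c0 leqn0 => /eqP ->].
(* The bit is the adjacency of [p] to [b m], and [F3] applies to the pair [(p, b m)] because
   [y m (b m)] holds. The next item uses [(a m, q)] in the same way. *)
- have [mn|nm] := leqP m n; last by rewrite row_bit_gt.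
  have cs l : (l < h)%N -> (c l < c l.+1)%N.
    by move=> lh; apply: cL => //; rewrite (leq_trans (cM _ _ lh)) // (leq_trans cm).
  have h1 := cs k.+1; have h2 := cs k.+2.
  have h3 : (c k.+3 <= c h)%N by apply: cM; lia.
  have m0 : (0 < m.-1 <= n)%N by lia.
  have [[i ic xp] _] := hf p; rewrite row_bitE; last lia.
  apply: (F3 (f p) i m.-1) => //; first by rewrite fk; lia.
  rewrite /y prednK; last lia.
  by rewrite (col_bit_b hg) ?leqnn //; lia.
- have [->//|m0] := eqVneq m 0%N.
  have k6 : (6 < k)%N.
    by case: leqP => //; rewrite -subn_eq0 => /eqP k0; move: cm; rewrite k0 c0; lia.
  have [|j cj yq] := B2 q (g q).-1; first lia.
  have jn : (j < n)%N by case: ltnP => // nj; rewrite /y col_bit_gt in yq.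
  have h1 : (c (k - 6)%N.+1 <= c (g q).-1)%N by apply: cM; lia.
  have h2 := cS (k - 6)%N.
  have mn : (0 < m <= n)%N by lia.
  rewrite col_bitE //; apply: (F3 (k - 6)%N m j) => //; first lia.
  by rewrite /x (row_bit_a hg) ?leqnn.
have [mn|nm] := ltnP m n; last by rewrite col_bit_gt.
have := B1 q m; apply; apply: leq_trans (cm).
apply: cL; first lia.
exact: leq_trans cm (ltnW mn).
Qed.

(** * The induction on the sizes of the omitted matchings *)

Lemma has_induced_matching0 (P Q : finType) (E : P -> Q -> bool) :
  has_induced_matching E 0.
Proof.
have e (T : Type) (i : 'I_0) : T by case: i.
by apply: (@has_induced_matchingI _ _ E 0 (e P) (e Q)) => -[].
Qed.

(** The successor accounts for the extra colour outside a reduced rectangle; [d] stays fixed because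
    it bounds the test sets throughout while [s] and [t] decrease. *)
Fixpoint color_bound (d n : nat) : nat :=
  if n is n'.+1 then
    (2 * 5 * (((color_bound d n').+1 ^ (4 * (4 * d + 1)) * (color_bound d n').+1 ^ 3) ^ 11) ^ (2 * 5))%N
  else 1.

Lemma color_bound_gt0 d n : (0 < color_bound d n)%N.
Proof. by case: n => //= n; rewrite !(muln_gt0, expn_gt0). Qed.

Lemma omits_chain_coloring d n s t (P Q : finType) (E : P -> Q -> bool) :
  (s <= d)%N -> (t <= d)%N -> (s + t <= n)%N -> omits E s t ->
  chain_coloring E (color_bound d n) (fun _ _ => True).
Proof.
elim: n s t P Q E => [|n IH] s t P Q E sd td stn [noE noC].
  by case: noE; case: s stn {sd} => // _; exact: has_induced_matching0.
case: s sd stn noE => [|s] sd stn noE; first by case: noE; exact: has_induced_matching0.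
case: t td stn noC => [|t] td stn noC; first by case: noC; exact: has_induced_matching0.
apply: reduced_chain_coloring.
- by split; [apply: contra_not noE|apply: contra_not noC]; apply: has_induced_matching_le.
- by rewrite ltnS color_bound_gt0.
apply: (@reduced_coloring _ _ E s t) => // P' Q' E' [om|om].
  by apply: IH om; lia.
by apply: IH om; lia.
Qed.

(** * Star number, sign-rank and growth *)

(** The centre is the constant [s]. On the first [d.+1] columns of the matching its last row agrees
    with the centre and serves as [c_0], while each other row differs from the centre exactly at its
    own column. *)
Lemma induced_matching_smax (m n : nat) (A : 'M[bool]_(m, n)) (s : bool) (d : nat) :
  has_induced_matching (fun i j => A i j != s) d.+2 -> (d < smax A)%N.
Proof.
move=> [p [q [_ injq M]]].
pose w := widen_ord (leqnSn d.+1).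
have injw : injective w by move=> k l /(congr1 val) kl; apply: val_inj.
have injx : injective (q \o w) by move=> k l /injq/injw.
pose h : {ffun 'I_n -> bool} := [ffun=> s].
pose pt : {ffun 'I_d.+1 -> 'I_n} := [ffun j => q (w j)].
pose row_of i : {ffun 'I_n -> bool} := [ffun j => A i j].
pose c : {ffun 'I_d.+2 -> {ffun 'I_n -> bool}} :=
  [ffun i => row_of (if unlift ord0 i is Some k then p (w k) else p ord_max)].
have star : has_star (concept_class A) h d.+1.
  apply/existsP; exists pt; apply/existsP; exists c; apply/and3P; split.
  - by apply/injectiveP => k l; rewrite !ffunE => /injx.
  - by apply/forallP => i; rewrite ffunE; apply/imsetP; eexists.
  apply/forallP => i; apply/forallP => j; rewrite !ffunE -[_ == s]negbK.
  case: unliftP => [k ->|->]; rewrite M.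
    by rewrite (inj_eq injw) (inj_eq lift_inj).
  by rewrite neq_lift -val_eqE /= gtn_eqF.
have dn : (d.+1 < #|'I_n|.+1)%N by rewrite ltnS -[d.+1]card_ord (leq_card _ injx).
apply: leq_trans (leq_bigmax h); rewrite /star_number.
exact: (@leq_bigmax_cond _ (fun i : 'I_(#|'I_n|.+1) => has_star (concept_class A) h i)
  (fun i => i : nat) (Ordinal dn)).
Qed.

Lemma smax_omits (m n : nat) (A : 'M[bool]_(m, n)) (d : nat) :
  (smax A <= d)%N -> omits (fun i j => A i j) d.+2 d.+2.
Proof.
move=> Ad; split=> M.
  suff : (d < smax A)%N by rewrite ltnNge Ad.
  apply: (induced_matching_smax (s := false)).
  by case: M => p [q [ip iq M]]; exists p, q; split=> // i j; rewrite -M; case: (A _ _).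
suff : (d < smax A)%N by rewrite ltnNge Ad.
apply: (induced_matching_smax (s := true)).
by case: M => p [q [ip iq M]]; exists p, q; split=> // i j; rewrite -M /bip_compl; case: (A _ _).
Qed.

Section SignRankBound.
Variables (R : realType) (m n : nat) (A : 'M[bool]_(m, n)).
Local Open Scope ring_scope.

(* Rows of S have nested traces on T: A i j holds iff all the rows of S that
   miss j have a trace strictly contained in that of i. *)
Lemma chain_block_rank2 (S : {set 'I_m}) (T : {set 'I_n}) :
  ~ has_induced_matching (@bip_induced _ _ (fun i j => A i j) S T) 2 ->
  exists B : 'M[R]_(m, n), [/\ (\rank B <= 2)%N,
    forall i j, i \in S -> j \in T -> sgz (B i j) = sign_val (A i j) &
    forall i j, ~~ ((i \in S) && (j \in T)) -> B i j = 0].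
Proof.
move=> noM.
pose N i := [set j in T | A i j]%SET.
pose al i := #|[set k in S | N k \proper N i]%SET|.
pose be j := #|[set k in S | ~~ A k j]%SET|.
have nested i k j : i \in S -> k \in S -> j \in T -> A i j -> ~~ A k j -> N k \proper N i.
  move=> iS kS jT Aij Akj; apply/fintype.properP; split; last first.
    by exists j; rewrite !inE jT ?Aij ?(negbTE Akj).
  apply/fintype.subsetP => j'; rewrite !inE => /andP[j'T Akj']; rewrite j'T /=.
  apply/negPn/negP => Aij'; apply: noM.
  pose p (e : 'I_2) : {i | i \in S} := if e == ord0 then exist _ i iS else exist _ k kS.
  pose q (e : 'I_2) : {j | j \in T} := if e == ord0 then exist _ j jT else exist _ j' j'T.
  apply: (@has_induced_matchingI _ _ _ _ p q) => e e'; rewrite /bip_induced /p /q.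
  by case: e => [[|[|//]] ?]; case: e' => [[|[|//]] ?];
     rewrite /= ?Aij ?Akj' ?(negbTE Akj) ?(negbTE Aij').
have AE i j : i \in S -> j \in T -> A i j = (be j <= al i)%N.
  move=> iS jT; case Aij: (A i j).
    apply/esym/subset_leq_card/fintype.subsetP => k; rewrite !inE => /andP[kS Akj].
    by rewrite kS (nested _ _ j).
  (* If [i] misses [j], so do all rows with a smaller trace, and [i] itself makes the inclusion
     strict. *)
  apply/esym/negbTE; rewrite -ltnNge; apply/proper_card/fintype.properP; split.
    apply/fintype.subsetP => k; rewrite !inE => /andP[kS /fintype.properP[/fintype.subsetP sub _]].
    rewrite kS /=; apply/negP => Akj; have := sub j.
    by rewrite !inE jT Akj Aij => /(_ isT).
  by exists i; rewrite !inE iS ?Aij // fintype.properxx.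
(* On the block the entry is [2 * al i + 1 - 2 * be j]: it is odd, hence nonzero, and has the sign
   of the comparison. *)
pose U : 'M[R]_(m, 1 + 1) := row_mx (\col_i ((i \in S)%:R * (2 * al i + 1)%:R)) (\col_i (i \in S)%:R).
pose V : 'M[R]_(1 + 1, n) := col_mx (\row_j (j \in T)%:R) (\row_j (- ((j \in T)%:R * (2 * be j)%:R))).
have BE i j : (U *m V) i j = ((i \in S) && (j \in T))%:R * ((2 * al i + 1)%:R - (2 * be j)%:R).
  rewrite mul_row_col !mxE !big_ord1 !mxE.
  by case: (i \in S); case: (j \in T); rewrite /= ?mul0r ?mul1r ?mulr0 ?mulr1 ?oppr0 ?addr0.
exists (U *m V); split; first exact: mulmx_max_rank.
- move=> i j iS jT; rewrite BE iS jT mul1r AE //; case: leqP => h /=.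
    by apply: gtr0_sgz; rewrite subr_gt0 ltr_nat; lia.
  by apply: ltr0_sgz; rewrite subr_lt0 ltr_nat; lia.
by move=> i j /negbTE h; rewrite BE h mul0r.
Qed.

Lemma sign_rank_chain_partition (u : nat) (Ps : 'I_u -> {set 'I_m}) (Qs : 'I_u -> {set 'I_n}) :
  is_partition Ps -> is_partition Qs ->
  (forall i j, ~ has_induced_matching (@bip_induced _ _ (fun i j => A i j) (Ps i) (Qs j)) 2) ->
  (sign_rank R A <= 2 * u ^ 2)%N.
Proof.
move=> partP partQ /(_ _ _)/chain_block_rank2 H.
have [B HB] := choice (fun k : 'I_u * 'I_u => H k.1 k.2).
pose M := \sum_k B k.
have rkM : (\rank M <= 2 * u ^ 2)%N.
  have : (\rank M <= \sum_(k : 'I_u * 'I_u) 2)%N.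
    rewrite /M; elim/big_ind2: _ => [|M1 r1 M2 r2 h1 h2|k _]; first by rewrite mxrank0.
      exact: leq_trans (mxrank_add _ _) (leq_add h1 h2).
    by case: (HB k).
  by rewrite sum_nat_const card_prod card_ord mulnC mulnn.
apply: leq_trans rkM; rewrite /sign_rank; case: ex_minnP => r _; apply.
apply/asboolP; exists M => // i j.
have [i0 [ii0 ui]] := partP i; have [j0 [jj0 uj]] := partQ j.
rewrite /M summxE (bigD1 (i0, j0)) //= big1 ?addr0.
  by case: (HB (i0, j0)) => _ -> .
case=> k l kl; case: (HB (k, l)) => _ _; apply.
by apply: contra kl => /andP[/= /ui -> /uj ->].
Qed.

End SignRankBound.

(** * Growth of the bound *)

Section Growth.
Local Open Scope ring_scope.
Variables (R : realType) (c k : nat).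
Hypothesis c0 : (0 < c)%N.

(** The witness is the base 2 logarithm of [(c * d.+1) ^ (k * d.+1)]. For [d >= 3] and [d >= c] one
    has [c * d.+1 <= d ^ 3] and [k * d.+1 <= 2 * k.+1 * d], whence the factor 6. *)
Lemma double_exp_bounded_pow (F : nat -> nat) :
  (forall d, (F d <= 2 ^ ((c * d.+1) ^ (k * d.+1)))%N) -> double_exp_bounded R F.
Proof.
move=> HF; have l2 : 0 < ln 2 :> R by apply: ln_gt0; rewrite ltr1n.
exists (fun d => (k * d.+1)%:R * (ln (c * d.+1)%:R / ln 2)); last first.
  move=> d; have Z0 : (0 : R) < (c * d.+1)%:R by rewrite ltr0n muln_gt0 c0.
  have -> : 2 `^ ((k * d.+1)%:R * (ln (c * d.+1)%:R / ln 2)) = ((c * d.+1) ^ (k * d.+1))%:R :> R.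
    rewrite {1}/powR pnatr_eq0 /= mulrA divfK ?gt_eqF //.
    by rewrite expRM_natl lnK ?posrE // natrX.
  by rewrite powR_mulrn // -natrX ler_nat.
apply/eqO_exP; exists (6 * k.+1%:R / ln 2).
  by rewrite divr_gt0 // mulr_gt0.
near=> d.
have d3 : (3 <= d)%N by near: d; exact: nbhs_infty_ge.
have dc : (c <= d)%N by near: d; exact: nbhs_infty_ge.
have d0 : (0 : R) < d%:R by rewrite ltr0n; lia.
have ld : 0 <= ln d%:R :> R by apply: ln_ge0; rewrite ler1n; lia.
have Z0 : (0 : R) < (c * d.+1)%:R by rewrite ltr0n muln_gt0 c0.
have lZ : 0 <= ln (c * d.+1)%:R :> R by apply: ln_ge0; rewrite ler1n muln_gt0 c0.
rewrite (ger0_norm (mulr_ge0 (ltW d0) ld)) ger0_norm; last first.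
  by rewrite mulr_ge0 // divr_ge0 // ltW.
have le1 : ln (c * d.+1)%:R <= 3 * ln d%:R :> R.
  rewrite mulr_natl -lnXn // ler_ln ?posrE ?exprn_gt0 // -natrX ler_nat.
  rewrite expnS leq_mul //; nia.
have le2 : (k * d.+1)%:R <= 2 * k.+1%:R * d%:R :> R by rewrite -!natrM ler_nat; nia.
rewrite (_ : 6 * k.+1%:R / ln 2 * (d%:R * ln d%:R) =
  2 * k.+1%:R * d%:R * (3 * ln d%:R / ln 2)); last by field; rewrite gt_eqF.
apply: ler_pM => //; first by rewrite divr_ge0 // ltW.
by rewrite ler_pM2r // invr_gt0.
Unshelve. all: by end_near.
Qed.

End Growth.

(** One step raises the bound plus one to the power [e] and multiplies by [10 <= 2 ^ 4]; the factor
    6 absorbs this, since [4 + (G + 1) * e <= 6 * (e * G)]. *)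
Lemma color_bound_le (d n : nat) :
  (color_bound d n <= 2 ^ ((6 * ((16 * d + 7) * 110)) ^ n))%N.
Proof.
set e := ((16 * d + 7) * 110)%N; have e0 : (0 < e)%N by rewrite muln_gt0 addn_gt0 orbT.
elim: n => [|n IH] //=; set G := (_ ^ n)%N in IH.
have G0 : (0 < G)%N by rewrite expn_gt0 muln_gt0 e0.
have -> : ((6 * e) ^ n.+1 = 6 * (e * G))%N by rewrite expnS mulnA.
rewrite -expnD -!expnM (_ : (_ * (11 * _))%N = e); last by congr (_ * _)%N; lia.
have h1 : ((color_bound d n).+1 <= 2 ^ G.+1)%N.
  by rewrite expnS mul2n -addnn -[X in (X <= _)%N]addn1 leq_add // expn_gt0.
apply: (@leq_trans (2 ^ 4 * (2 ^ G.+1) ^ e)%N).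
  by apply: leq_mul => //; rewrite leq_exp2r.
by rewrite -expnM -expnD leq_exp2l // mulSn; nia.
Qed.

Theorem theorem1p9 (R : realType) :
  exists f : nat -> nat,
    [/\ atminas_function R f,
        forall (d m n : nat) (A : 'M[bool]_(m, n)),
          (smax A <= d)%N -> (sign_rank R A <= 2 * f d ^ 2)%N &
        double_exp_bounded R (fun d => (2 * f d ^ 2)%N)].
Proof.
(* The shift by 2: a matching of size d + 2 gives only a star of size d + 1,
   one of its rows serving as the concept c_0. *)
pose f d := color_bound d.+2 (d.+2 + d.+2); exists f.
(* From [16 * d.+2 + 7 <= 39 * d.+1]; likewise [d.+2 + d.+2 <= 4 * d.+1] gives the exponent. *)
pose c := (6 * (39 * 110))%N; have c3 : (3 <= c)%N by [].
have f_le d : (f d <= 2 ^ ((c * d.+1) ^ (4 * d.+1)))%N.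
  apply: leq_trans (color_bound_le _ _) _; rewrite leq_exp2l //.
  apply: (@leq_trans ((c * d.+1) ^ (d.+2 + d.+2))%N).
    by rewrite leq_exp2r // /c; lia.
  by rewrite leq_pexp2l ?muln_gt0 //; lia.
have f_chain d s (P Q : finType) (E : P -> Q -> bool) :
    (s <= d.+2)%N -> omits E s s -> chain_coloring E (f d) (fun _ _ => True).
  by move=> sd; apply: omits_chain_coloring => //; exact: leq_add.
split.
- split=> [d P Q E noE noC|]; last exact: (@double_exp_bounded_pow R c 4).
  have [|Ps [Qs [partP partQ H]]] := chain_coloring_true (f_chain d d P Q E _ (conj noE noC)).
    by rewrite ltnW.
  by exists (f d), Ps, Qs.
- move=> d m n A /smax_omits om.
  have [Ps [Qs [partP partQ H]]] := chain_coloring_true (f_chain d _ _ _ _ (leqnn _) om).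
  exact: sign_rank_chain_partition partP partQ H.
(* Squaring and doubling turn the exponent [X] into [1 + 2 * X], at most [X ^ 2] for [X >= 3]; so 4
   becomes 8. *)
apply: (@double_exp_bounded_pow R c 8) => // d.
set X := ((c * d.+1) ^ (4 * d.+1))%N in f_le.
have X3 : (3 <= X)%N.
  apply: leq_trans c3 _; rewrite -[leqLHS]expn1.
  by apply: (@leq_trans (c ^ (4 * d.+1))%N); [rewrite leq_pexp2l|rewrite leq_exp2r // leq_pmulr].
have -> : ((c * d.+1) ^ (8 * d.+1) = X ^ 2)%N by rewrite /X -expnM; congr (_ ^ _)%N; lia.
apply: (@leq_trans (2 ^ (1 + X * 2))%N).
  by rewrite expnD leq_mul // expnM leq_exp2r.
by rewrite leq_exp2l //; nia.
Qed.
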